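(* Let $K$ be an algebraically closed field of characteristic zero and let $n\geq 1$ be an integer. Let $W_3(n)$ be the set of Waring ranks of reducible cubic forms in $n+1$ variables over $K$, i.e. $$W_3(n)=\{\, rk(LQ) \;:\; L,Q\in K[x_0,\ldots,x_n] \text{ nonzero homogeneous polynomials},\ \deg L=1,\ \deg Q=2 \,\}.$$ Then $$W_3(n)\subseteq \{1,\ldots,2n+1\}.$$
   Context: For a nonzero homogeneous polynomial (form) $F\in K[x_0,\ldots,x_n]$ of degree $d$, the Waring rank (or rank) $rk(F)$ is the least integer $s$ such that there exist linear forms $L_1,\ldots,L_s\in K[x_0,\ldots,x_n]$ with $F=L_1^d+\cdots+L_s^d$. A reducible cubic form in $n+1$ variables is a form $F=LQ$ with $L$ a nonzero linear form and $Q$ a nonzero quadratic form in $K[x_0,\ldots,x_n]$ ($Q$ may itself be reducible or a square). *)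

(* Defs.v *)
From mathcomp Require Import all_boot all_order all_algebra.
From mathcomp Require Import boolp classical_sets.
From mathcomp Require Import mpoly.

Set Implicit Arguments.
Unset Strict Implicit.
Unset Printing Implicit Defensive.

Import GRing.Theory.

Local Open Scope classical_set_scope.
Local Open Scope ring_scope.

(* The zero polynomial belongs to 1.-homog; allowing zero summands does not
   change the least length of a decomposition. *)
Definition sum_of_powers (R : comNzRingType) (m d : nat)
    (F : {mpoly R[m]}) (s : nat) : Prop :=
  exists L : 'I_s -> {mpoly R[m]},
    (forall i, L i \is 1.-homog) /\ F = \sum_(i < s) L i ^+ d.

Definition is_waring_rank (R : comNzRingType) (m d : nat)
    (F : {mpoly R[m]}) (s : nat) : Prop :=
  sum_of_powers d F s /\ forall t, sum_of_powers d F t -> (s <= t)%N.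

(* The value is 0 when F is not a sum of d-th powers of linear forms at all.
   A nonzero F never has rank 0, so for nonzero F a positive value is the
   genuine least length. *)
Definition waring_rank (R : comNzRingType) (m d : nat)
    (F : {mpoly R[m]}) : nat :=
  xget 0%N [set s | is_waring_rank d F s].

Definition reducible_cubic (R : comNzRingType) (m : nat) :
    set {mpoly R[m]} :=
  [set F | exists L Q : {mpoly R[m]},
     [/\ L != 0, L \is 1.-homog, Q != 0, Q \is 2.-homog & F = L * Q]].

Definition W3 (K : closedFieldType) (n : nat) : set nat :=
  [set waring_rank 3 F | F in @reducible_cubic K n.+1].

(* Main.v *)
(* Modulo L, diagonalising Q gives LQ = L (L N + M_1^2 + ... + M_k^2) with
   k <= n.  Each L M_i^2 is, up to a multiple of L^3, a combination of the two
   cubes (L + M_i)^3 and (L - M_i)^3, and L^2 N' is a combination of three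
   cubes.  This gives 2 k + 3 <= 2 n + 1 cubes when k < n.  When k = n the
   forms L, M_1, ..., M_n span all linear forms, and completing squares makes
   N a multiple of L, so that L^2 N only contributes to the L^3 term and
   2 n + 1 cubes suffice.  Both cases come out of one induction that completes
   the squares including the cross terms with L. *)
Require Import Defs.
From mathcomp Require Import all_boot all_order all_algebra.
From mathcomp Require Import boolp classical_sets.
From mathcomp Require Import mpoly.
From mathcomp Require Import ring zify.

Set Implicit Arguments.
Unset Strict Implicit.
Unset Printing Implicit Defensive.

Import GRing.Theory.

Local Open Scope classical_set_scope.
Local Open Scope ring_scope.

(** * Roots of scalars *)

Lemma closed_root_exists (K : closedFieldType) (d : nat) (a : K) :
  (0 < d)%N -> exists b, b ^+ d = a.
Proof.
case: d => // d _.
(* The coefficient list [[:: a]] has only a constant term, so the monic equation solved here is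
   [b ^+ d = a]. *)
have [b Hb] := @GRing.solve_monicpoly K d.+1 (nth 0 [:: a]) isT.
exists b; rewrite Hb big_ord_recl /= big1 ?addr0 ?expr0 ?mulr1 // => i _.
by rewrite nth_nil mul0r.
Qed.

(** * Spans of linear forms and quadratic forms in given generators *)

Section Spans.

Variables (K : fieldType) (m : nat).
Implicit Types (p q L v : {mpoly K[m]}) (s t : seq {mpoly K[m]}).

Inductive lin s : {mpoly K[m]} -> Prop :=
| lin0 : lin s 0
| lin_gen a v p : v \in s -> lin s p -> lin s (a%:MP * v + p).

(** Quadratic forms in the elements of [s], given by products instead of a symmetric matrix, so that
    a change of generators is immediate. *)
Inductive quad s : {mpoly K[m]} -> Prop :=
| quad0 : quad s 0
| quad_gen p p' q : lin s p -> lin s p' -> quad s q -> quad s (p * p' + q).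

Lemma lin_mem s v : v \in s -> lin s v.
Proof. by move=> /(@lin_gen s 1 v 0) /(_ (lin0 s)); rewrite mul1r addr0. Qed.

Lemma linD s p p' : lin s p -> lin s p' -> lin s (p + p').
Proof.
move=> Hp Hp'; elim: Hp => [|a v r Hv _ IH]; first by rewrite add0r.
by rewrite -addrA; apply: lin_gen.
Qed.

Lemma linZ s a p : lin s p -> lin s (a%:MP * p).
Proof.
elim=> [|b v r Hv _ IH]; first by rewrite mulr0; apply: lin0.
by rewrite mulrDr mulrA -mpolyCM; apply: lin_gen.
Qed.

Lemma linN s p : lin s p -> lin s (- p).
Proof. by move=> /(linZ (-1)); rewrite mpolyCN mulN1r. Qed.

Lemma linB s p p' : lin s p -> lin s p' -> lin s (p - p').
Proof. by move=> Hp /linN; apply: linD. Qed.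

Lemma lin_trans s t p :
  (forall v, v \in s -> lin t v) -> lin s p -> lin t p.
Proof.
move=> Hst; elim=> [|a v r /Hst Hv _ IH]; first exact: lin0.
exact/linD/IH/linZ.
Qed.

Lemma sub_lin s t p : {subset s <= t} -> lin s p -> lin t p.
Proof. by move=> Hst; apply: lin_trans => v /Hst; apply: lin_mem. Qed.

Lemma lin_tail v s p : lin s p -> lin (v :: s) p.
Proof. by apply: sub_lin => w; rewrite inE orbC => ->. Qed.

Lemma lin_homog s p :
  {in s, forall v, v \is 1.-homog} -> lin s p -> p \is 1.-homog.
Proof.
move=> Hs; elim=> [|a v r /Hs Hv _ IH]; first exact: dhomog0.
by rewrite rpredD // mul_mpolyC rpredZ.
Qed.

Lemma lin_nil p : lin [::] p -> p = 0.
Proof. by case. Qed.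

Lemma lin_consP v s p :
  lin (v :: s) p -> exists a r, lin s r /\ p = a%:MP * v + r.
Proof.
elim=> [|b w p' Hw _ [a [r [Hr ->]]]].
  by exists 0, 0; rewrite mpolyC0 mul0r addr0; split => //; apply: lin0.
move: Hw; rewrite inE => /orP[/eqP->|Hw].
  by exists (b + a), r; split => //; rewrite mpolyCD mulrDl addrA.
exists a, (b%:MP * w + r); split; first exact: lin_gen.
by rewrite addrCA.
Qed.

Lemma quadD s q q' : quad s q -> quad s q' -> quad s (q + q').
Proof.
move=> Hq Hq'; elim: Hq => [|p p' r Hp Hp' _ IH]; first by rewrite add0r.
by rewrite -addrA; apply: quad_gen.
Qed.

Lemma quadM s p p' : lin s p -> lin s p' -> quad s (p * p').
Proof. by move=> Hp Hp'; rewrite -[_ * _]addr0; apply: quad_gen => //; left. Qed.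

Lemma quad_trans s t q :
  (forall p, lin s p -> lin t p) -> quad s q -> quad t q.
Proof.
by move=> Hst; elim=> [|p p' r /Hst Hp /Hst Hp' _ IH]; [left | right].
Qed.

Lemma quad_nil q : quad [::] q -> q = 0.
Proof.
by elim=> // p p' r /lin_nil-> _ _ ->; rewrite mul0r addr0.
Qed.

(** Isolates the variable [v] for completing the square: its square, its cross terms, and a rest in
    the other generators. *)
Lemma quad_consP v s q :
  quad (v :: s) q ->
  exists a l q', [/\ lin s l, quad s q' & q = a%:MP * v ^+ 2 + v * l + q'].
Proof.
elim=> [|p p' r].
  exists 0, 0, 0; split; [exact: lin0 | exact: quad0 |].
  by rewrite mpolyC0; ring.
move=> /lin_consP[b [u [Hu ->]]] /lin_consP[c [w [Hw ->]]] _.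
move=> [a [l [q' [Hl Hq' ->]]]].
exists (b * c + a), (b%:MP * w + c%:MP * u + l), (u * w + q'); split.
- by apply: linD => //; apply: linD; apply: linZ.
- by apply: quadD => //; apply: quadM.
- by rewrite mpolyCD mpolyCM; ring.
Qed.

(** Steinitz exchange: a generator with nonzero coefficient in [l] can be solved for, so [l]
    replaces it. *)
Lemma lin_exchange s l : lin s l -> l != 0 ->
  exists t, [/\ size s = (size t).+1, {subset t <= s} &
    forall p, lin s p -> lin (l :: t) p].
Proof.
elim: s l => [|w s IH] l; first by move=> /lin_nil->; rewrite eqxx.
move=> /lin_consP[a [r [Hr Dl]]] nz_l.
case: (eqVneq a 0) => [a0|nz_a].
  have Er: l = r by rewrite Dl a0 mpolyC0 mul0r add0r.
  rewrite -Er in Hr; have [t [Hsz Hts Hlin]] := IH _ Hr nz_l.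
  exists (w :: t); split; first by rewrite /= Hsz.
    by move=> v; rewrite !inE => /orP[->//|/Hts->]; rewrite orbT.
  move=> p; apply: lin_trans => v; rewrite inE => /orP[/eqP->|Hv].
    by apply: lin_mem; rewrite !inE eqxx orbT.
  apply: (@sub_lin (l :: t)); last by apply: Hlin; apply: lin_mem.
  by move=> u; rewrite !inE => /orP[->//|->]; rewrite !orbT.
exists s; split=> //; first by move=> v Hv; rewrite inE Hv orbT.
move=> p; apply: lin_trans => v; rewrite inE => /orP[/eqP->|Hv]; last first.
  by apply: lin_mem; rewrite inE Hv orbT.
have ->: w = a^-1%:MP * (l - r).
  by rewrite Dl addrK mulrA -mpolyCM mulVf // mul1r.
apply/linZ/linB; first by apply: lin_mem; rewrite mem_head.
exact: lin_tail.
Qed.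

Lemma lin_homog1 p : p \is 1.-homog -> lin [seq 'X_i | i : 'I_m] p.
Proof.
move=> /dhomogP hp; rewrite [p]mpolyE big_seq.
elim/big_ind: _ => [||u /hp /eqP/mdeg1P[i /eqP->]]; [exact: lin0 | exact: linD |].
by rewrite -mul_mpolyC; apply/linZ/lin_mem/map_f; rewrite mem_enum.
Qed.

Lemma quad_homog2 q : q \is 2.-homog -> quad [seq 'X_i | i : 'I_m] q.
Proof.
move=> /dhomogP hq; rewrite [q]mpolyE big_seq.
elim/big_ind: _ => [||u /hq /= Hu]; [exact: quad0 | exact: quadD |].
have /existsP[i Hi] : [exists i : 'I_m, u i != 0%N].
  apply: contra_eqT Hu; rewrite negb_exists => /forallP Hi.
  by rewrite mdegE big1 // => i _; apply/eqP; rewrite -[_ == _]negbK Hi.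
have Du : u = (U_(i) + (u - U_(i)))%MM.
  by rewrite addmC submK // lep1mP.
have /mdeg1P[j /eqP Dj] : mdeg (u - U_(i))%MM == 1%N.
  by move: Hu; rewrite {1}Du mdegD mdeg1 add1n => -[->].
rewrite Du Dj mpolyXD -mul_mpolyC mulrA.
by apply: quadM; [apply: linZ|]; apply/lin_mem/map_f; rewrite mem_enum.
Qed.

End Spans.

(** * Completing squares relative to a linear form *)

Section SumsOfPowers.

Variables (K : closedFieldType) (m : nat).
Hypothesis pchar0 : [pchar K]%R =i pred0.
Implicit Types (F G L M N : {mpoly K[m]}) (s : seq {mpoly K[m]}).

Lemma natr_neq0 k : (0 < k)%N -> k%:R != 0 :> K.
Proof. by rewrite (pcharf0P K).1 // lt0n. Qed.

(** Strong induction on [size s], since one case consumes two generators. A generator with nonzero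
    square coefficient costs one square; one that enters only through [v * l] with [l != 0] is
    consumed together with a generator exchanged for [l], at the cost of two squares; otherwise it
    is moved into [N'] and costs none. If the sizes agree, the last case never occurred, so only [L]
    is left in [N']. *)
Lemma complete_squares L s N q : lin (L :: s) N -> quad s q ->
  exists Ms N',
    [/\ {in Ms, forall M, lin (L :: s) M}, lin (L :: s) N',
        L * N + q = L * N' + \sum_(M <- Ms) M ^+ 2,
        (size Ms <= size s)%N &
        size Ms = size s -> exists c, N' = c%:MP * L].
Proof.
have [k] := ubnP (size s).
elim: k => // k IH in s N q *; case: s => [|v t] ltsk.
  move=> HN /quad_nil->; exists [::], N; split=> //; first by rewrite big_nil.
  move=> _; have [c [r [/lin_nil-> ->]]] := lin_consP HN.
  by exists c; rewrite addr0.
rewrite ltnS /= in ltsk.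
move=> HN; have {HN}: lin (v :: L :: t) N.
  by apply: sub_lin HN => w; rewrite !inE orbCA.
move=> /lin_consP[c [N' [HN' ->]]] /quad_consP[a [l [q' [Hl Hq' ->]]]].
have HL u : lin (L :: u) L by apply: lin_mem; rewrite mem_head.
have two0 : 2%:R != 0 :> K by apply: natr_neq0.
have weak p : lin (L :: t) p -> lin (L :: v :: t) p.
  by apply: sub_lin => w; rewrite !inE => /orP[->//|->]; rewrite !orbT.
have [a0|nz_a] := eqVneq a 0; last first.
  have [b Db] := closed_root_exists a (isT : 0 < 2)%N.
  have nz_b : b != 0 by apply: contraNneq nz_a => b0; rewrite -Db b0 expr0n.
  (* Since [2 b e = 1], the square of [M] below contains [a v^2 + v (l + c L)]. Its excess
     [e^2 (l + c L)^2] is subtracted from [q'] and, where [L] divides, from [N']. *)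
  pose e := (2%:R * b)^-1.
  have be : b%:MP_[m] * e%:MP * 2%:R = 1.
    rewrite -mpolyC_nat -!mpolyCM /e; congr (_%:MP).
    by field; rewrite nz_b two0.
  pose M := b%:MP * v + e%:MP * (l + c%:MP * L).
  have Hl' := lin_tail L Hl.
  have [||Ms [N1 [HMs HN1 E1 Hsz Heq]]] := IH t
      (N' - (2%:R * e ^+ 2 * c)%:MP * l - (e ^+ 2 * c ^+ 2)%:MP * L)
      (q' + (- e ^+ 2)%:MP * l * l) ltsk.
  - by apply: linB; [apply: linB => //|]; apply: linZ.
  - by apply: quadD => //; apply: quadM => //; apply: linZ.
  exists (M :: Ms), N1; split.
  - move=> w; rewrite inE => /orP[/eqP->|/HMs/weak//].
    apply: linD; first by apply/linZ/lin_mem; rewrite !inE eqxx orbT.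
    by apply/linZ/linD; [apply: weak | apply/linZ/HL].
  - exact: weak.
  - rewrite big_cons [RHS]addrCA -E1 /M -Db.
    rewrite !(mpolyCD, mpolyCM, mpolyCN, mpolyC_nat).
    ring: be.
  - by rewrite /= ltnS.
  - by move=> [] /Heq.
have {a0} -> : a%:MP * v ^+ 2 = 0 :> {mpoly K[m]} by rewrite a0 mpolyC0 mul0r.
rewrite add0r.
(* If [l = 0], no square is produced for [v], so the sizes differ and the last clause is vacuous. *)
have [l0|nz_l] := eqVneq l 0.
  have [Ms [N1 [HMs HN1 E1 Hsz Heq]]] := IH t N' q' ltsk HN' Hq'.
  exists Ms, (N1 + c%:MP * v); split.
  - by move=> w /HMs/weak.
  - by apply: linD; [apply: weak | apply/linZ/lin_mem; rewrite !inE eqxx orbT].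
  - by rewrite [in RHS]mulrDr [RHS]addrAC -E1 l0; ring.
  - exact: leqW.
  - by move=> E; move: Hsz; rewrite E /= ltnn.
have [t' [Hsz' Ht' Hlin]] := lin_exchange Hl nz_l.
have: lin (l :: L :: t') N'.
  apply: lin_trans HN' => w; rewrite inE => /orP[/eqP->|Hw].
    by apply: lin_mem; rewrite !inE eqxx orbT.
  apply: (@sub_lin _ _ (l :: t')); last by apply: Hlin; apply: lin_mem.
  by move=> u; rewrite !inE => /orP[->//|->]; rewrite !orbT.
move=> /lin_consP[d [N'' [HN'' ->]]].
have /quad_consP[a' [p [q'' [Hp Hq'' ->]]]] := quad_trans Hlin Hq'.
have weak' w : lin (L :: t') w -> lin (L :: v :: t) w.
  move=> Hw; apply/weak; apply: sub_lin Hw => u.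
  by rewrite !inE => /orP[->//|/Ht'->]; rewrite orbT.
(* [l] now plays the role of the generator of [t] exchanged for it, and
   [v + a' l + p] that of [v]; the cross terms of both with [L] are absorbed
   in a single product [X * Y], a sum of two squares. *)
pose v' := v + a'%:MP * l + p.
pose d' := d - c * a'.
pose X := l + c%:MP * L.
pose Y := v' + d'%:MP * L.
have ltt' : (size t' < k)%N by apply: leq_trans ltsk; rewrite Hsz'.
(* Substituting [v = v' - a' l - p] in [c v] contributes [- c p]; the term [c d' L^2] in the
   expansion of [X * Y] is compensated by [- c d' L]. *)
have [|//|Ms [N1 [HMs HN1 E1 Hsz Heq]]] := IH t'
    (N'' - c%:MP * p - (c * d')%:MP * L) q'' ltt'.
- apply: linB; last exact/linZ/HL.
  by apply: linB => //; apply/linZ/lin_tail.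
(* With [i^2 = -1] and [h = 1/2], [X Y = (h (X + Y))^2 + (i h (X - Y))^2]. *)
have [i Di] := closed_root_exists (-1 : K) (isT : 0 < 2)%N.
pose h := (2%:R : K)^-1.
have hh : h%:MP_[m] * 2%:R = 1.
  by rewrite -mpolyC_nat -mpolyCM /h mulVf.
have ii : (i%:MP_[m]) ^+ 2 = -1 by rewrite -rmorphXn Di rmorphN1.
have HX : lin (L :: v :: t) X.
  by apply: linD; [apply/weak/lin_tail | apply/linZ/HL].
have HY : lin (L :: v :: t) Y.
  apply: linD; last exact/linZ/HL.
  apply: linD; last exact/weak'/lin_tail.
  apply: linD; first by apply: lin_mem; rewrite !inE eqxx orbT.
  exact/linZ/weak/lin_tail.
exists [:: h%:MP * (X + Y), (i * h)%:MP * (X - Y) & Ms], N1; split.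
- move=> w; rewrite !inE => /or3P[/eqP->|/eqP->|/HMs/weak'//].
    exact/linZ/linD.
  exact/linZ/linB.
- exact: weak'.
- rewrite !big_cons.
  have -> : L * N1 + ((h%:MP * (X + Y)) ^+ 2 + (((i * h)%:MP * (X - Y)) ^+ 2
      + \sum_(M <- Ms) M ^+ 2)) = (L * N1 + \sum_(M <- Ms) M ^+ 2)
      + (h%:MP * 2%:R) ^+ 2 * (X * Y)
      + (i%:MP ^+ 2 + 1) * h%:MP ^+ 2 * (X - Y) ^+ 2.
    by rewrite mpolyCM; ring.
  rewrite -E1 hh ii /X /Y /d' /v' !(mpolyCB, mpolyCM); ring.
- by rewrite /= Hsz' !ltnS.
- by rewrite /= Hsz' => -[] /Heq.
Qed.

(** * Counting cubes *)

Lemma sum_of_powers0 d : sum_of_powers d (0 : {mpoly K[m]}) 0.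
Proof. by exists (fun=> 0); split=> [[]|] //; rewrite big_ord0. Qed.

Lemma sum_of_powersD d F G k l :
  sum_of_powers d F k -> sum_of_powers d G l -> sum_of_powers d (F + G) (k + l).
Proof.
move=> [A [hA ->]] [B [hB ->]].
exists (fun i => match split i with inl j => A j | inr j => B j end); split.
  by move=> i; case: (split i).
rewrite big_split_ord; congr (_ + _); apply: eq_bigr => i _.
  by rewrite -/(unsplit (inl i)) unsplitK.
by rewrite -/(unsplit (inr i)) unsplitK.
Qed.

Lemma sum_of_powers_pow d c L : (0 < d)%N ->
  L \is 1.-homog -> sum_of_powers d (c%:MP * L ^+ d) 1.
Proof.
move=> d_gt0 hL; have [b Db] := closed_root_exists c d_gt0.
exists (fun=> b%:MP * L); split=> [_|]; first by rewrite mul_mpolyC rpredZ.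
by rewrite big_ord1 exprMn -rmorphXn Db.
Qed.

(** [(L + M)^3 + (L - M)^3 = 2 L^3 + 6 L M^2]. The [L^3] term is kept so that these terms for
    several [M] can be corrected together. *)
Lemma sum_of_cubes_mul_sqr L M : L \is 1.-homog -> M \is 1.-homog ->
  sum_of_powers 3 (L * M ^+ 2 + (3%:R^-1)%:MP * L ^+ 3) 2.
Proof.
move=> hL hM; pose c := (6%:R : K)^-1.
have -> : L * M ^+ 2 + (3%:R^-1)%:MP * L ^+ 3
    = c%:MP * (L + M) ^+ 3 + c%:MP * (L - M) ^+ 3.
  have c6 : c%:MP_[m] * 6%:R = 1.
    by rewrite -mpolyC_nat -mpolyCM mulVf // natr_neq0.
  have -> : 3%:R^-1 = c * 2%:R by rewrite /c; field; rewrite !natr_neq0.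
  rewrite mpolyCM mpolyC_nat; ring: c6.
by apply: (@sum_of_powersD _ _ _ 1 1); apply: sum_of_powers_pow;
  rewrite // (rpredB, rpredD).
Qed.

(** The previous identity with [L] and [M] exchanged; a third cube cancels the multiple of [M^3]. *)
Lemma sum_of_cubes_sqr_mul L M : L \is 1.-homog -> M \is 1.-homog ->
  sum_of_powers 3 (L ^+ 2 * M) 3.
Proof.
move=> hL hM.
have -> : L ^+ 2 * M = (M * L ^+ 2 + (3%:R^-1)%:MP * M ^+ 3)
    + (- 3%:R^-1)%:MP * M ^+ 3.
  by rewrite mpolyCN; ring.
apply: (@sum_of_powersD _ _ _ 2 1); first exact: sum_of_cubes_mul_sqr.
exact: sum_of_powers_pow.
Qed.

Lemma sum_of_cubes_mul_sum_sqr L Ms :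
  L \is 1.-homog -> {in Ms, forall M, M \is 1.-homog} ->
  sum_of_powers 3
    (L * (\sum_(M <- Ms) M ^+ 2) + ((size Ms)%:R / 3%:R)%:MP * L ^+ 3)
    (2 * size Ms).
Proof.
move=> hL; elim: Ms => [|M Ms IH] hMs.
  by rewrite big_nil mul0r mpolyC0 mulr0 mul0r addr0; apply: sum_of_powers0.
have -> : L * (\sum_(N <- M :: Ms) N ^+ 2)
      + ((size (M :: Ms))%:R / 3%:R)%:MP * L ^+ 3
    = (L * M ^+ 2 + (3%:R^-1)%:MP * L ^+ 3)
      + (L * (\sum_(N <- Ms) N ^+ 2) + ((size Ms)%:R / 3%:R)%:MP * L ^+ 3).
  by rewrite big_cons /= -[(size Ms).+1%:R]natr1 mulrDl div1r mpolyCD; ring.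
rewrite /= mulnS; apply: sum_of_powersD.
  by apply: sum_of_cubes_mul_sqr => //; apply: hMs; rewrite mem_head.
by apply: IH => N HN; apply: hMs; rewrite inE HN orbT.
Qed.

End SumsOfPowers.

(** * The bound on the rank *)

Lemma reducible_cubic_sum_of_cubes (K : closedFieldType) (n : nat)
    (L Q : {mpoly K[n.+1]}) :
  [pchar K]%R =i pred0 -> L != 0 -> L \is 1.-homog -> Q \is 2.-homog ->
  exists2 k, (k <= 2 * n + 1)%N & sum_of_powers 3 (L * Q) k.
Proof.
move=> hK nz_L hL hQ.
have [s [Hsz Hs Hlin]] := lin_exchange (lin_homog1 hL) nz_L.
have hs : {in L :: s, forall v, v \is 1.-homog}.
  move=> v; rewrite inE => /orP[/eqP->//|/Hs/mapP[i _ ->]].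
  by rewrite dhomogX /= mdeg1.
have {Hsz} Hsz : size s = n.
  by move: Hsz; rewrite size_map size_enum_ord => -[].
have /quad_consP[a [l [q [Hl Hq ->]]]] := quad_trans Hlin (quad_homog2 hQ).
(* All terms of the quadratic form divisible by [L] are gathered in [L * (a L + l)]; [q] involves
   only the [n] generators in [s]. *)
have HN : lin (L :: s) (a%:MP * L + l).
  by apply: linD (lin_tail _ Hl); apply/linZ/lin_mem; rewrite mem_head.
have [Ms [N [HMs HN' E1 Hk Heq]]] := complete_squares hK HN Hq.
rewrite Hsz in Hk Heq.
have {}HMs : {in Ms, forall M, M \is 1.-homog}.
  by move=> M /HMs; apply: lin_homog.
have {HN'} hN := lin_homog hs HN'.
pose b : K := (size Ms)%:R / 3%:R.
have -> : L * (a%:MP * L ^+ 2 + L * l + q)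
    = (L * (\sum_(M <- Ms) M ^+ 2) + b%:MP * L ^+ 3)
      + L ^+ 2 * (N - b%:MP * L).
  have -> : a%:MP * L ^+ 2 + L * l + q = L * (a%:MP * L + l) + q by ring.
  by rewrite E1; ring.
have Hsq := sum_of_cubes_mul_sum_sqr hK hL HMs.
(* With [n] squares, the term in [L^2] is a multiple of [L^3], a single cube; with at most [n - 1],
   three cubes still fit, as [2 (n - 1) + 3 = 2 n + 1]. *)
have [Ek|Hlt] := eqVneq (size Ms) n.
  have [c ->] := Heq Ek.
  exists (2 * size Ms + 1)%N; first by rewrite Ek.
  apply: sum_of_powersD => //.
  have -> : L ^+ 2 * (c%:MP * L - b%:MP * L) = (c - b)%:MP * L ^+ 3.
    by rewrite mpolyCB; ring.
  exact: sum_of_powers_pow.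
exists (2 * size Ms + 3)%N; first by lia.
apply: sum_of_powersD => //; apply: sum_of_cubes_sqr_mul => //.
by rewrite rpredB // mul_mpolyC rpredZ.
Qed.

Lemma is_waring_rank_exists (R : comNzRingType) (m d : nat)
    (F : {mpoly R[m]}) (k : nat) :
  sum_of_powers d F k ->
  exists2 s, is_waring_rank d F s & (s <= k)%N.
Proof.
move=> Hk; have exP : exists s, `[< sum_of_powers d F s >].
  by exists k; apply/asboolP.
case: (ex_minnP exP) => s /asboolP Hs min_s; exists s.
  by split=> // t /asboolP/min_s.
by apply/min_s/asboolP.
Qed.

Theorem theorem1p3 (K : closedFieldType) (hK : [pchar K]%R =i pred0)
    (n : nat) (hn : (1 <= n)%N) :
  W3 K n `<=` [set r | (1 <= r <= 2 * n + 1)%N].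
Proof.
move=> _ [_ [L [Q [nz_L hL nz_Q hQ ->]]] <-] /=.
have [k Hk /is_waring_rank_exists[s Hs le_sk]] :=
  reducible_cubic_sum_of_cubes hK nz_L hL hQ.
(* As [s] is a rank, [xget] returns a genuine rank and not merely its default [0]. *)
have [HW minW] : is_waring_rank 3 (L * Q) (waring_rank 3 (L * Q)).
  exact: (xgetI 0%N Hs).
apply/andP; split; last first.
  exact: leq_trans (minW _ Hs.1) (leq_trans le_sk Hk).
(* Rank [0] would make [L * Q] an empty sum, whereas both factors are nonzero. *)
rewrite lt0n; apply/eqP => r0; move: HW; rewrite r0 => -[M [_ E]].
by move: E; rewrite big_ord0 => /eqP; rewrite mulf_eq0 (negPf nz_L) (negPf nz_Q).
Qed.
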